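(* There is an algorithm which, given a positive integer $n$, computes the $n$th prime $p_n$ in $O(\sqrt{n}\,(\log n)^4)$ time.
   Context: Here $p_n$ denotes the $n$th prime number ($p_1=2,p_2=3,\dots$), $\log$ is the natural logarithm, and $\pi(x)$ is the number of primes less than or equal to $x$. Time is measured in the cost model in which the known algorithm of Hirsch, Kessler and Mendlovic evaluates $\pi(x)$ in $O(\sqrt{x}\,(\log x)^{5/2})$ time; this algorithm is available for use as a subroutine. The algorithm in question is binary search for $p_n$ using evaluations of $\pi$, over the interval $[L,R]$ with $L=n(\log n+\log\log n-1)$ and $R=n(\log n+\log\log n)$; by a known theorem of Dusart, $L<p_n<R$ for all $n\ge 6$. *)

(* Defs.v *)
From mathcomp Require Import all_boot all_order all_algebra.
From mathcomp Require Import all_classical all_reals all_analysis.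
Set Implicit Arguments.
Unset Strict Implicit.
Unset Printing Implicit Defensive.

Import Order.TTheory GRing.Theory Num.Theory.
Import numFieldNormedType.Exports.

Local Open Scope classical_set_scope.
Local Open Scope nat_scope.

(** * Primes *)

Definition primepi (x : nat) : nat := count prime (iota 0 x.+1).

Lemma next_prime_subproof (m : nat) : exists p, (m < p) && prime p.
Proof. by have [p lt_mp pr_p] := prime_above m; exists p; rewrite lt_mp. Qed.

Definition next_prime (m : nat) : nat := ex_minn (next_prime_subproof m).

(* Numbered from 1: nth_prime 1 = 2, nth_prime 2 = 3; nth_prime 0 = 0 is a
   dummy value. *)
Definition nth_prime (n : nat) : nat := iter n next_prime 0.

(** * Algorithms: programs of a unit-cost word RAM

    Programs are a first-order datatype, so that a program can only compute
    by executing instructions, each of which is charged for.  The memory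
    consists of words with natural-number addresses and contents; the
    arguments i, j, l below are direct addresses and play the role of
    registers. *)

Definition memory := nat -> nat.

Inductive binop := Add | Sub | Mul | Div | Mod.

Definition eval_binop (o : binop) : nat -> nat -> nat :=
  match o with
  | Add => addn | Sub => subn | Mul => muln | Div => divn | Mod => modn
  end.

Inductive prog :=
| Skip
| Const of nat & nat                  (* Const i c   : M[i] := c           *)
| Op of binop & nat & nat & nat       (* Op o i j l  : M[i] := M[j] o M[l] *)
| Read of nat & nat                   (* Read i j    : M[i] := M[M[j]]     *)
| Write of nat & nat                  (* Write i j   : M[M[i]] := M[j]     *)
| Seq of prog & prog
| If of nat & prog & prog             (* If i p q    : test M[i] != 0      *)
| While of nat & prog                 (* While i p   : test M[i] != 0      *)
| Call of nat & prog & nat.           (* Call i p j  : M[i] := p(M[j])     *)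

Definition upd (m : memory) (i v : nat) : memory := [eta m with i |-> v].

(* Convention for both whole programs and subroutines: the argument is passed
   and the result returned in cell 0, all other cells being initially 0. *)
Definition init_memory (x : nat) : memory := upd (fun=> 0) 0 x.

(* [exec B p m m' t]: started in memory m, the program p halts in memory m'
   after t elementary steps, on a machine whose words hold the numbers 0..B.
   There is no rule for an instruction producing a value above B, so a run
   that overflows a word has no result.  A subroutine works on a memory region
   of its own, on the same machine, and all its steps are charged to the
   caller. *)
Inductive exec (B : nat) : prog -> memory -> memory -> nat -> Prop :=
| ExecSkip m : exec B Skip m m 0
| ExecConst i c m : c <= B -> exec B (Const i c) m (upd m i c) 1
| ExecOp o i j l m : eval_binop o (m j) (m l) <= B ->
    exec B (Op o i j l) m (upd m i (eval_binop o (m j) (m l))) 1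
| ExecRead i j m : exec B (Read i j) m (upd m i (m (m j))) 1
| ExecWrite i j m : exec B (Write i j) m (upd m (m i) (m j)) 1
| ExecSeq p q m1 m2 m3 t u : exec B p m1 m2 t -> exec B q m2 m3 u ->
    exec B (Seq p q) m1 m3 (t + u)
| ExecIfTrue i p q m m' t : m i != 0 -> exec B p m m' t ->
    exec B (If i p q) m m' t.+1
| ExecIfFalse i p q m m' t : m i = 0 -> exec B q m m' t ->
    exec B (If i p q) m m' t.+1
| ExecWhileStop i p m : m i = 0 -> exec B (While i p) m m 1
| ExecWhileLoop i p m1 m2 m3 t u : m1 i != 0 -> exec B p m1 m2 t ->
    exec B (While i p) m2 m3 u -> exec B (While i p) m1 m3 (t + u).+1
| ExecCall i p j m m' t : exec B p (init_memory (m j)) m' t ->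
    exec B (Call i p j) m (upd m i (m' 0)) t.+1.

(* [computes p f g]: the program p computes f(n) from every positive integer n
   in O(g(n)) time.  Words hold numbers up to (n + 2)^k for a constant k,
   i.e. they have O(log n) bits; without such a bound, unit-cost arithmetic
   would be unrealistically powerful. *)
Definition computes (R : realType) (p : prog) (f : nat -> nat)
    (g : nat -> R) : Prop :=
  exists (k : nat) (T : nat -> nat),
    (forall n, 0 < n -> exists2 m : memory,
       exec ((n + 2) ^ k) p (init_memory n) m (T n) & m 0 = f n) /\
    (fun n => (T n)%:R%R : R) =O_\oo g.

(* Main.v *)
Require Import Defs.
From mathcomp Require Import all_boot all_order all_algebra.
From mathcomp Require Import all_classical all_reals all_analysis.
From mathcomp Require Import zify ring lra.

(** The nth prime is the least [x] with [n <= primepi x], so it can be found by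
searching for the place where [primepi] reaches [n].  The program doubles a
bound until it finds the first power [2 ^ j] with [n <= primepi (2 ^ j)], and
then bisects below [2 ^ j] ([search_correct]).  This needs no prior estimate of
the nth prime, costs [2 * j + 1] evaluations of [primepi], and evaluates it only
at arguments up to [2 ^ j], which is less than twice the nth prime.

The running time therefore rests on an upper bound for [2 ^ j], and Chebyshev's
argument gives one.  Every prime power dividing a binomial coefficient ['C(N, k)]
is at most [N] ([logn_bin]), so ['C(N, k) <= N ^ primepi N], while
[2 ^ m <= 'C(m.*2, m)].  At powers of two this reads
[2 ^ i <= i.+1 * primepi (2 ^ i.+1)], and minimality of [j] turns it into
[2 ^ j <= 4 * j * n] ([first_pow2_primepi]).

Two consequences follow.  First, [2 ^ j <= 32 * n ^ 2], so every number that
occurs, and every word of a call, is polynomial in [n], and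
[j] is O(log n).  Feeding this back, [2 ^ j] is O(n log n).  Second, the total
time is O(log n) evaluations, each costing
O(sqrt(n log n) (log n)^(5/2)) = O(sqrt n (log n)^3), which is the announced
O(sqrt n (log n)^4) ([search_cost_le]). *)

Set Implicit Arguments.
Unset Strict Implicit.

Import Order.TTheory GRing.Theory Num.Theory.
Import numFieldNormedType.Exports.

Local Open Scope nat_scope.

(** * The nth prime as the place where primepi reaches n *)

Lemma primepi_mono : {homo primepi : x y / x <= y}.
Proof.
move=> x y le_xy; rewrite /primepi -(subnKC le_xy) -addSn iotaD count_cat.
exact: leq_addr.
Qed.

Lemma primepiS x : primepi x.+1 = primepi x + prime x.+1.
Proof. by rewrite /primepi -(addn1 x.+1) iotaD count_cat /= !addn0 add0n. Qed.

Lemma primepi_next_prime x : primepi (next_prime x) = (primepi x).+1.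
Proof.
rewrite /next_prime; case: ex_minnP => p /andP[lt_xp pr_p] min_p.
suff gap y : x <= y < p -> primepi y = primepi x.
  case: p pr_p lt_xp gap {min_p} => // p pr_p lt_xp gap.
  by rewrite primepiS pr_p gap ?addn1; lia.
elim: y => [|y IHy] hy; first by congr primepi; lia.
have [->//|lt_xy] : x = y.+1 \/ x <= y by lia.
rewrite primepiS IHy ?lt_xy; last by lia.
case: (boolP (prime y.+1)) => [pr_y|_]; last by rewrite addn0.
by have := min_p y.+1; rewrite pr_y ltnS lt_xy => /(_ isT); lia.
Qed.

Lemma primepi_nth_prime n : primepi (nth_prime n) = n.
Proof. by elim: n => [//|n IHn]; rewrite /= primepi_next_prime IHn. Qed.

(** The characterization by which the outcome of a search for a jump of [primepi]
is recognized as the nth prime. *)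
Lemma nth_prime_unique n v : primepi v < n <= primepi v.+1 -> nth_prime n = v.+1.
Proof.
case: n => // n /andP[lt_vn le_nv].
have pr_v: prime v.+1 by move: le_nv; rewrite primepiS; case: prime; lia.
have def_n : primepi v = n by move: le_nv; rewrite primepiS; case: prime; lia.
have lt_nv : nth_prime n < v.+1.
  rewrite ltnNge; apply/negP => /primepi_mono; rewrite primepi_nth_prime; lia.
apply/eqP; rewrite eqn_leq; apply/andP; split; last first.
  rewrite ltnNge; apply/negP => /primepi_mono; rewrite primepi_nth_prime; lia.
rewrite /= /next_prime; case: ex_minnP => p _; apply.
by rewrite lt_nv.
Qed.

(** * Chebyshev's lower bound for primepi *)

(** One step from [m] to [m.+1] doubles the central coefficient at least: by
Pascal's rule and symmetry ['C(m.*2.+2, m.+1)] is twice ['C(m.*2.+1, m)]. *)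
Lemma expn2_le_bin m : 2 ^ m <= 'C(m.*2, m).
Proof.
elim: m => // m IHm.
rewrite doubleS binS.
have -> : 'C(m.*2.+1, m.+1) = 'C(m.*2.+1, m).
  by rewrite -(@bin_sub _ m); [congr 'C(_, _)|]; lia.
rewrite addnn -mul2n expnS leq_mul2l /= (leq_trans IHm) //.
by case: m {IHm} => // m; rewrite binS leq_addr.
Qed.

(** By Legendre's formula the exponent of [p] in ['C(N, k)] is the sum over [i] of
[N %/ p ^ i - k %/ p ^ i - (N - k) %/ p ^ i].  Each term is at most 1, being a
carry of an addition in base [p], and it vanishes once [p ^ i > N]. *)
Lemma logn_bin p N k : prime p -> k <= N -> 0 < N -> p ^ logn p 'C(N, k) <= N.
Proof.
move=> pr_p le_kN N_gt0.
apply: (@leq_trans (p ^ trunc_log p N)); last exact: trunc_logP (prime_gt1 pr_p) _.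
rewrite leq_exp2l ?prime_gt1 //.
set t := trunc_log p N.
(* All three factorials are expanded over the same range, so that the sums
   can be compared term by term. *)
have lgE n : n <= N -> logn p n`! = \sum_(1 <= i < N.+1) n %/ p ^ i.
  move=> le_nN; rewrite logn_fact //.
  rewrite [RHS](big_cat_nat _ (n := n.+1) (p := N.+1)) //=.
  rewrite [X in _ = _ + X](_ : _ = 0) ?addn0 // big_nat big1 // => i /andP[lt_ni _].
  by rewrite divn_small // (ltn_trans lt_ni) // ltn_expl ?prime_gt1.
have := congr1 (logn p) (bin_fact le_kN).
rewrite !lognM ?muln_gt0 ?fact_gt0 ?bin_gt0 // !lgE ?leq_subr //.
rewrite -big_split /= => /eqP.
suff: \sum_(1 <= i < N.+1) N %/ p ^ i <=
    t + \sum_(1 <= i < N.+1) (k %/ p ^ i + (N - k) %/ p ^ i) by lia.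
have -> : t = \sum_(1 <= i < N.+1) (i <= t).
  have le_tN : t <= N.
    rewrite (leq_trans (ltnW (ltn_expl t (prime_gt1 pr_p)))) //.
    by rewrite trunc_logP // prime_gt1.
  rewrite (big_cat_nat _ (n := t.+1) (p := N.+1)) //=.
  rewrite big_nat (eq_bigr (fun=> 1)); last by move=> i /andP[_]; rewrite ltnS => ->.
  rewrite -big_nat sum_nat_const_nat subn1 muln1 /=.
  rewrite [X in _ + X](_ : _ = 0) ?addn0 // big_nat big1 // => i /andP[lt_ti _].
  by rewrite leqNgt lt_ti.
rewrite -big_split; apply: leq_sum => i _ /=.
have pi_gt0 : 0 < p ^ i by rewrite expn_gt0 prime_gt0.
case: (leqP i t) => [_|lt_ti]; last first.
  rewrite (@divn_small N) //.
  apply: (leq_trans (trunc_log_ltn N (prime_gt1 pr_p))).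
  by rewrite leq_exp2l ?prime_gt1.
by rewrite -{1}(subnKC le_kN) divnD //; lia.
Qed.

(** The coefficient is the product of its prime powers, each at most [N] by
[logn_bin], over at most [primepi N] primes. *)
Lemma bin_le_expn_primepi N k : 0 < N -> k <= N -> 'C(N, k) <= N ^ primepi N.
Proof.
move=> N_gt0 le_kN.
have C_gt0 : 0 < 'C(N, k) by rewrite bin_gt0.
rewrite {1}(prod_prime_decomp C_gt0) prime_decompE big_map /=.
apply: (@leq_trans (N ^ size (primes 'C(N, k)))); last first.
  apply: leq_pexp2l => //; rewrite /primepi -size_filter.
  apply: uniq_leq_size (primes_uniq _) _ => p p_C.
  have pr_p : prime p by move: p_C; rewrite mem_primes => /andP[].
  rewrite mem_filter pr_p mem_iota /= add0n ltnS.
  apply: leq_trans (logn_bin pr_p le_kN N_gt0).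
  by rewrite -{1}(expn1 p) leq_exp2l ?prime_gt1 // logn_gt0.
have : all prime (primes 'C(N, k)).
  by apply/allP => p; rewrite mem_primes => /andP[].
elim: (primes _) => [|p s IHs] /=; rewrite ?big_nil // big_cons.
by case/andP=> pr_p /IHs le_s; rewrite expnS leq_mul // logn_bin.
Qed.

(** This is [2 ^ m <= (2 * m) ^ primepi (2 * m)] at [m = 2 ^ i], where the
logarithms in base 2 are integers. *)
Lemma primepi_pow2_lower_bound i : 2 ^ i <= i.+1 * primepi (2 ^ i.+1).
Proof.
rewrite -(@leq_exp2l 2) // (leq_trans (expn2_le_bin _)) //.
rewrite expnM expnS mul2n bin_le_expn_primepi //; first by rewrite double_gt0 expn_gt0.
by rewrite -addnn leq_addr.
Qed.

Lemma square_le_expn2 i : i * i <= 2 * 2 ^ i.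
Proof.
suff: i * i <= 2 * 2 ^ i /\ 2 * i + 1 <= 2 * 2 ^ i by case.
elim: i => // i [sq_i lin_i]; rewrite expnS; nia.
Qed.

(** The power before the first that reaches [n] has fewer than [n] primes below
it, so the lower bound on [primepi] bounds that power, hence also its double. *)
Lemma first_pow2_primepi n : 0 < n -> exists j,
  [/\ n <= primepi (2 ^ j), forall i, i < j -> primepi (2 ^ i) < n
    & 2 ^ j <= 4 * j * n].
Proof.
move=> n_gt0.
have ex_j : exists j, n <= primepi (2 ^ j).
  exists (nth_prime n); rewrite -{1}(primepi_nth_prime n).
  by apply/primepi_mono/ltnW/ltn_expl.
case: (ex_minnP ex_j) => j le_nj min_j.
have lt_n i : i < j -> primepi (2 ^ i) < n.
  by move=> lt_ij; rewrite ltnNge; apply/negP => /min_j; rewrite leqNgt lt_ij.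
(* The lower bound is available from 2 ^ 1 on, so it applies to the
   predecessor of 2 ^ j when j >= 2; j = 1 is immediate. *)
case: j le_nj min_j lt_n => [|[|i]] le_nj min_j lt_n.
- by move: le_nj; rewrite leqNgt n_gt0.
- by exists 1; split=> //; rewrite !expn1 muln1; lia.
exists i.+2; split=> //.
have := primepi_pow2_lower_bound i; have := lt_n i.+1 (ltnSn _).
have -> : 2 ^ i.+2 = 4 * 2 ^ i by rewrite !expnS; lia.
by nia.
Qed.

(** Squaring the hypothesis and using [j * j <= 2 * 2 ^ j] removes [j] from the
right-hand side. *)
Lemma pow2_le_32_square j n : 2 ^ j <= 4 * j * n -> 2 ^ j <= 32 * n ^ 2.
Proof.
move=> le_j.
have := leq_mul le_j le_j; have := square_le_expn2 j.
have : 0 < 2 ^ j by rewrite expn_gt0.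
move: (2 ^ j) => X X_gt0 jX XX.
rewrite -(leq_pmul2l X_gt0) (leq_trans XX) //.
have -> : 4 * j * n * (4 * j * n) = 16 * (n * n) * (j * j) by ring.
have -> : X * (32 * n ^ 2) = 16 * (n * n) * (2 * X) by rewrite -mulnn; ring.
by rewrite leq_mul2l jX orbT.
Qed.

(** * Total correctness with time bounds *)

Local Arguments upd _ _ _ _ /.
Local Arguments init_memory _ _ /.

(** Total correctness in at most [T] steps.  The postcondition is a parameter so
that programs can be verified by weakest preconditions: in [terminates_seq] the
postcondition of the first part is the termination of the second. *)
Definition terminates B p m T (Q : memory -> Prop) :=
  exists m' t, [/\ exec B p m m' t, t <= T & Q m'].

Lemma terminates_weaken B p m T T' (Q Q' : memory -> Prop) :
  terminates B p m T Q -> T <= T' -> (forall m', Q m' -> Q' m') ->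
  terminates B p m T' Q'.
Proof.
by move=> [m' [t [ex le_t Qm]]] le_T QQ'; exists m', t; split; [|lia|apply: QQ'].
Qed.

Lemma terminates_skip B m T (Q : memory -> Prop) :
  Q m -> terminates B Skip m T Q.
Proof. by move=> Qm; exists m, 0; split=> //; constructor. Qed.

Lemma terminates_const B i c m (Q : memory -> Prop) :
  c <= B -> Q (upd m i c) -> terminates B (Const i c) m 1 Q.
Proof. by move=> cB Qm; exists (upd m i c), 1; split=> //; constructor. Qed.

Lemma terminates_op B o i j l m (Q : memory -> Prop) :
  eval_binop o (m j) (m l) <= B -> Q (upd m i (eval_binop o (m j) (m l))) ->
  terminates B (Op o i j l) m 1 Q.
Proof. by move=> cB Qm; eexists _, 1; split; [constructor| |exact: Qm]. Qed.

Lemma terminates_seq B p q m T U (Q : memory -> Prop) :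
  terminates B p m T (fun m' => terminates B q m' U Q) ->
  terminates B (Seq p q) m (T + U) Q.
Proof.
move=> [m1 [t [ex_p le_t [m2 [u [ex_q le_u Qm]]]]]].
by exists m2, (t + u); split; [apply: ExecSeq ex_p ex_q|lia|].
Qed.

Lemma terminates_if B i p q m T (Q : memory -> Prop) :
  (m i != 0 -> terminates B p m T Q) -> (m i = 0 -> terminates B q m T Q) ->
  terminates B (If i p q) m T.+1 Q.
Proof.
have [mi0 _ /(_ mi0)|mi_n0 /(_ isT) + _] := eqVneq (m i) 0.
  by move=> [m' [t [ex ? Qm]]]; exists m', t.+1; split=> //; apply: ExecIfFalse.
by move=> [m' [t [ex ? Qm]]]; exists m', t.+1; split=> //; apply: ExecIfTrue.
Qed.

(** The invariant [I] carries the exact number of iterations left, which serves as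
both the variant and the time bound. *)
Lemma terminates_while B i p T (I : nat -> memory -> Prop) r m :
  (forall m, I 0 m -> m i = 0) ->
  (forall r m, I r.+1 m -> m i != 0 /\ terminates B p m T (I r)) ->
  I r m -> terminates B (While i p) m (r * T.+1).+1 (I 0).
Proof.
move=> I0 IS; elim: r m => [|r IHr] m Im.
  by exists m, 1; split=> //; constructor; exact: I0.
have [mi_n0 [m1 [t [ex_p le_t /IHr]]]] := IS _ _ Im.
move=> [m2 [u [ex_w le_u Im2]]]; exists m2, (t + u).+1; split=> //.
  exact: ExecWhileLoop ex_p ex_w.
by rewrite mulSn; lia.
Qed.

(** The caller sees only cell 0 of the final memory of [p], which is why the
postcondition of the subroutine is fixed to its value. *)
Lemma terminates_call B i p j m T y (Q : memory -> Prop) :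
  terminates B p (init_memory (m j)) T (fun m' => m' 0 = y) ->
  Q (upd m i y) -> terminates B (Call i p j) m T.+1 Q.
Proof.
move=> [m' [t [ex le_t <-]]] Qm; exists (upd m i (m' 0)), t.+1.
by split=> //; constructor.
Qed.

(** A larger word size never invalidates a run; it lets a subroutine verified for
the word size of its own input run with the word size of the caller's. *)
Lemma exec_le_word B B' p m m' t : B <= B' -> exec B p m m' t -> exec B' p m m' t.
Proof.
move=> le_B; elim=> *; try by constructor.
- by constructor; lia.
- by constructor; lia.
- by econstructor; eassumption.
- by apply: ExecWhileLoop; eassumption.
Qed.

(** * Searching by doubling and bisection *)

(** Throughout, cell 0 holds the target [n], cell 1 the current power of two,
cell 2 the constant 2, and cell 3 the truncated difference [n - f x] for the last
probe [x], which is nonzero exactly when [f x < n]. *)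
Definition doubling (q : prog) : prog :=
  Seq (Const 1 1) (Seq (Const 2 2) (Seq (Call 3 q 1) (Seq (Op Defs.Sub 3 0 3)
    (While 3 (Seq (Op Mul 1 1 2) (Seq (Call 3 q 1) (Op Defs.Sub 3 0 3))))))).

(** Cell 5 holds the lower end of the bracket (initially 0) and cell 4 the
midpoint.  Cell 1 holds half the width of the bracket, so it becomes 0 by integer
division just when the bracket has width 1. *)
Definition bisection (q : prog) : prog :=
  Seq (Op Div 1 1 2)
    (While 1 (Seq (Op Add 4 5 1) (Seq (Call 3 q 4) (Seq (Op Defs.Sub 3 0 3)
      (Seq (If 3 (Op Add 5 5 1) Skip) (Op Div 1 1 2)))))).

Definition search (q : prog) : prog :=
  Seq (doubling q) (Seq (bisection q) (Seq (Const 6 1) (Op Add 0 5 6))).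

(** The function [f] is arbitrary: bisection keeps a bracket whose ends lie on
different sides of [n], and so ends at some [v] where [f] passes [n]. *)
Section Search.

Variables (B : nat) (q : prog) (f : nat -> nat) (n j tau : nat).
Hypothesis q_computes : forall x, 0 < x <= 2 ^ j ->
  terminates B q (init_memory x) tau (fun m => m 0 = f x).
Hypotheses (B_gt1 : 1 < B) (le_nB : n <= B) (le_jB : 2 ^ j <= B).
Hypotheses (f0 : f 0 < n) (fj : n <= f (2 ^ j)).
Hypothesis fi : forall i, i < j -> f (2 ^ i) < n.

Let bracketed r (m : memory) :=
  [/\ m 0 = n, m 2 = 2, f (m 5) < n <= f (m 5 + 2 ^ r) & m 5 + 2 ^ r <= 2 ^ j].

Lemma doubling_correct :
  terminates B (doubling q) (init_memory n) ((j + 1) * (tau + 5))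
    (fun m => m 1 = 2 ^ j /\ bracketed j m).
Proof.
(* With r doublings left, the current probe is 2 ^ (j - r). *)
pose I r (m : memory) := [/\ r <= j, m 0 = n, m 2 = 2,
  m 1 = 2 ^ (j - r) /\ m 3 = n - f (m 1) & m 5 = 0].
apply: (@terminates_weaken _ _ _
   (1 + (1 + (tau.+1 + (1 + (j * (1 + (tau.+1 + 1)).+1).+1)))) _ (I 0)).
- apply: terminates_seq; apply: terminates_const => //; first by lia.
  apply: terminates_seq; apply: terminates_const => //.
  apply: terminates_seq; apply: terminates_call.
    by apply: q_computes; rewrite /= expn_gt0.
  apply: terminates_seq; apply: terminates_op => /=; first by lia.
  apply: (@terminates_while _ _ _ _ I).
  + by move=> m [_ _ _ [-> ->] _]; rewrite subn0; apply/eqP; rewrite subn_eq0.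
  + move=> r m [lt_rj m0 m2 [m1 m3] m5]; split.
      by rewrite m3 m1 -lt0n subn_gt0 fi //; lia.
    have e : 2 ^ (j - r.+1) * 2 = 2 ^ (j - r) by rewrite -expnSr; congr (2 ^ _); lia.
    have le_e : 2 ^ (j - r) <= 2 ^ j by rewrite leq_exp2l ?leq_subr.
    apply: terminates_seq; apply: terminates_op; rewrite /= m1 m2 /= e; first by lia.
    apply: terminates_seq; apply: terminates_call.
      by apply: q_computes; rewrite /= expn_gt0.
    by apply: terminates_op; rewrite /= m0; [lia|split=> //=; lia].
  + by split; rewrite /= ?subnn.
- by nia.
move=> m [_ m0 m2 [m1 m3] m5]; move: m1; rewrite subn0 => m1.
by split=> //; split=> //; rewrite m5 add0n // f0.
Qed.

Lemma bisection_correct m : m 1 = 2 ^ j -> bracketed j m ->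
  terminates B (bisection q) m (j * (tau + 7) + 2) (bracketed 0).
Proof.
move=> m1 br_m.
pose I r (m : memory) := m 1 = 2 ^ r %/ 2 /\ bracketed r m.
have halfS r : 2 ^ r.+1 %/ 2 = 2 ^ r by rewrite expnS mulKn.
apply: (@terminates_weaken _ _ _
  (1 + (j * (1 + (tau.+1 + (1 + (1.+1 + 1)))).+1).+1) _ (I 0)).
- have [m0 m2 _ _] := br_m.
  apply: terminates_seq; apply: terminates_op; rewrite /= m1 m2.
    by rewrite (leq_trans (leq_div _ _)).
  apply: (@terminates_while _ _ _ _ I _ _ _ _ (conj _ _)) => //.
    by move=> m' [-> _].
  move=> {m1 br_m m0 m2}r {}m [m1 [m0 m2 fL le_L]]; rewrite halfS in m1.
  have [pow_gt0 powS] : 0 < 2 ^ r /\ 2 ^ r.+1 = 2 ^ r + 2 ^ r.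
    by rewrite expn_gt0 expnS mul2n addnn.
  rewrite powS addnA in fL le_L; split; first by rewrite m1 -lt0n.
  apply: terminates_seq; apply: terminates_op; rewrite /= m1; first by lia.
  apply: terminates_seq; apply: terminates_call.
    by apply: q_computes => /=; lia.
  apply: terminates_seq; apply: terminates_op; rewrite /= m0; first by lia.
  apply: terminates_seq; apply: terminates_if => /= test.
    have {}test : f (m 5 + 2 ^ r) < n by rewrite -subn_gt0 lt0n.
    apply: terminates_op; rewrite /= m1; first by lia.
    apply: terminates_op; rewrite /= m1 m2.
      by rewrite (leq_trans (leq_div _ _)); lia.
    by split=> //=; split=> //=; lia.
  have {}test : n <= f (m 5 + 2 ^ r) by apply/eqP.
  apply: terminates_skip.
  apply: terminates_op; rewrite /= m1 m2.
    by rewrite (leq_trans (leq_div _ _)); lia.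
  by split=> //=; split=> //=; lia.
- by nia.
by move=> m' [].
Qed.

Lemma search_correct :
  terminates B (search q) (init_memory n) ((2 * j + 1) * (tau + 10))
    (fun m => exists2 v, f v < n <= f v.+1 & m 0 = v.+1).
Proof.
have le_T : (j + 1) * (tau + 5) + (j * (tau + 7) + 2 + (1 + 1))
    <= (2 * j + 1) * (tau + 10) by nia.
apply: terminates_weaken le_T (fun _ => id).
apply: terminates_seq; apply: terminates_weaken doubling_correct _ _ => //.
move=> m [m1 br_m].
apply: terminates_seq.
apply: terminates_weaken (bisection_correct m1 br_m) _ _ => //.
move=> {br_m}m {m1}[m0 m2 fL le_L]; rewrite expn0 addn1 in fL le_L.
apply: terminates_seq; apply: terminates_const => //; first by lia.
by apply: terminates_op; rewrite /= addn1; [lia|exists (m 5)].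
Qed.

End Search.

Local Open Scope classical_set_scope.
Local Open Scope ring_scope.

(** * Cost estimates *)

Section Real.
Variable R : realType.

Lemma ln2_ge_half : 1 / 2 <= ln 2%:R :> R.
Proof.
have := @le_ln1Dx R (- (1 / 2)).
rewrite (_ : 1 + _ = 2%:R^-1); last by lra.
rewrite lnV ?posrE //; lra.
Qed.

Lemma powR_5_2 (x : R) : 0 <= x -> x `^ (5%:R / 2%:R) = x ^+ 2 * Num.sqrt x.
Proof.
move=> x_ge0; rewrite (_ : 5%:R / 2%:R = 2%:R + 2^-1 :> R); last by lra.
rewrite powRD; last by apply/implyP; lra.
by rewrite powR_mulrn // powR12_sqrt.
Qed.

(** An asymptotic bound says nothing about the finitely many small arguments,
whose costs the constant [D] absorbs; the resulting bound holds at every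
argument, as a search needs since it probes small arguments too. *)
Lemma eqO_affine_bound (T : nat -> nat) (g : nat -> R) :
  (fun n => (T n)%:R : R) =O_\oo g -> (forall n, 0 <= g n) ->
  exists C D : R, [/\ 0 <= C, 0 <= D & forall n, (T n)%:R <= D + C * g n].
Proof.
move/eqO_exP => [C C_gt0 [N _ hN]] g0.
exists C, (\sum_(i < N) (T i)%:R).
split; [exact: ltW|exact: sumr_ge0|move=> n].
have [lt_nN|le_Nn] := ltnP n N.
  rewrite (bigD1 (Ordinal lt_nN)) //= -addrA lerDl addr_ge0 ?sumr_ge0 ?mulr_ge0 //.
  exact: ltW.
have := hN n le_Nn; rewrite /= !ger0_norm // => /le_trans -> //.
by rewrite lerDr sumr_ge0.
Qed.

Definition pi_cost (x : nat) : R := Num.sqrt x%:R * ln x%:R `^ (5%:R / 2%:R).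

Lemma pi_cost_ge0 x : 0 <= pi_cost x.
Proof. by rewrite mulr_ge0 ?sqrtr_ge0 ?powR_ge0. Qed.

Lemma pi_cost_mono x y : (0 < x <= y)%N -> pi_cost x <= pi_cost y.
Proof.
move=> /andP[x_gt0 le_xy]; have y_gt0 := leq_trans x_gt0 le_xy.
apply: ler_pM; rewrite ?sqrtr_ge0 ?powR_ge0 //.
  by rewrite ler_wsqrtr // ler_nat.
apply: ge0_ler_powR; rewrite ?nnegrE ?ln_ge0 ?ler1n ?divr_ge0 //.
by rewrite ler_ln ?posrE ?ltr0n // ler_nat.
Qed.

(** With [l = ln n], the hypothesis on [2 ^ j] gives [ln (2 ^ j) <= 7 l],
[j <= 14 l] and [2 ^ j <= 56 n l].  So a probe costs at most
[C * 980 * sqrt n * l ^ 3], the half power of [l] in [sqrt (2 ^ j)] completing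
the [5/2] to an integer; constants are absorbed by [1 <= 8 * sqrt n * l ^ 3], and
there are at most [30 l] probes. *)
Lemma search_cost_le (j n : nat) (C D : R) : (1 < n)%N -> (2 ^ j <= 4 * j * n)%N ->
  0 <= C -> 0 <= D ->
  (2 * j + 1)%:R * (D + C * pi_cost (2 ^ j) + 10%:R) <=
  30%:R * (8%:R * (D + 10%:R) + 980%:R * C) * (Num.sqrt n%:R * ln n%:R ^+ 4).
Proof.
move=> n_gt1 le_j C_ge0 D_ge0.
have n_gt0 : (0 < n)%N by apply: ltnW.
have ln2 : 1 / 2 <= ln 2%:R :> R := ln2_ge_half.
have ln2n : ln 2%:R <= ln n%:R :> R by rewrite ler_ln ?posrE ?ltr0n // ler_nat.
have ln_pow2 : ln (2 ^ j)%:R = j%:R * ln 2%:R :> R.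
  by rewrite natrX lnXn ?ltr0n // mulr_natl.
have ln_X : ln (2 ^ j)%:R <= 7%:R * ln n%:R :> R.
  have X_gt0 : (0 < 2 ^ j)%N by rewrite expn_gt0.
  (* 32 n ^ 2 is at most n ^ 7, as 2 <= n. *)
  apply: (@le_trans _ _ (ln (2 ^ 5 * n ^ 2)%:R)).
    rewrite ler_ln ?posrE ?ltr0n ?muln_gt0 ?expn_gt0 ?n_gt0 // ler_nat.
    exact: pow2_le_32_square.
  rewrite natrM lnM ?posrE ?ltr0n ?expn_gt0 ?n_gt0 // !natrX !lnXn ?ltr0n //.
  lra.
move: ln2 ln2n ln_pow2 ln_X; set l := ln n%:R; set a := ln 2%:R.
move=> ln2 ln2n ln_pow2 ln_X.
have le_jl : j%:R <= 14%:R * l.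
  have := ler_wpM2l (ler0n R j) ln2; move: ln_X; rewrite ln_pow2.
  by move: (_%:R * a) => ja; lra.
have l_ge : 1 / 2 <= l by lra.
have l_ge0 : 0 <= l by lra.
have le_X : (2 ^ j)%:R <= 56%:R * n%:R * l.
  apply: (@le_trans _ _ (4 * j * n)%:R); first by rewrite ler_nat.
  have -> : (4 * j * n)%:R = 4%:R * (n%:R * j%:R) :> R by rewrite !natrM; ring.
  have -> : 56%:R * n%:R * l = 4%:R * (n%:R * (14%:R * l)) by ring.
  by rewrite ler_wpM2l // ler_wpM2l.
have sqrt_n : 1 <= Num.sqrt n%:R :> R.
  by rewrite -[X in X <= _]sqrtr1 ler_wsqrtr // ler1n.
have lnX_ge0 : 0 <= ln (2 ^ j)%:R :> R by rewrite ln_ge0 // ler1n expn_gt0.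
have le_cost : pi_cost (2 ^ j) <= 980%:R * (Num.sqrt n%:R * l ^+ 3).
  rewrite /pi_cost powR_5_2 //.
  have -> : 980%:R * (Num.sqrt n%:R * l ^+ 3) =
      (20%:R * Num.sqrt n%:R * l) * (7%:R * l) ^+ 2 by ring.
  rewrite mulrCA mulrC ler_pM ?mulr_ge0 ?sqrtr_ge0 ?sqr_ge0 //; last first.
    by rewrite lerXn2r ?nnegrE ?mulr_ge0.
  rewrite -sqrtrM //.
  (* 20 ^ 2 = 400 exceeds the constant 56 * 7 = 392 under the root. *)
  have -> : 20%:R * Num.sqrt n%:R * l = Num.sqrt (400%:R * n%:R * l ^+ 2).
    rewrite sqrtrM ?mulr_ge0 // sqrtr_sqr ger0_norm // sqrtrM //.
    by rewrite (_ : 400%:R = 20%:R ^+ 2) ?sqrtr_sqr ?ger0_norm //; ring.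
  rewrite ler_wsqrtr //.
  apply: (@le_trans _ _ ((56%:R * n%:R * l) * (7%:R * l))); first exact: ler_pM.
  rewrite (_ : _ * _ = 392%:R * (n%:R * l ^+ 2)); last by ring.
  by rewrite -[X in _ <= X]mulrA ler_wpM2r ?ler_nat // mulr_ge0 // sqr_ge0.
have l3 : 1 <= 8%:R * (Num.sqrt n%:R * l ^+ 3).
  have := @lerXn2r R 3 (1 / 2) l; rewrite !nnegrE => /(_ _ l_ge0 l_ge) l3_ge.
  have l3_ge0 : 0 <= l ^+ 3 by rewrite exprn_ge0.
  have := ler_peMl l3_ge0 sqrt_n; have := l3_ge ltac:(lra).
  rewrite expr_div_n expr1n; move: (Num.sqrt n%:R * _) => sl; lra.
apply: (@le_trans _ _ (30%:R * l *
    ((D + 10%:R) * (8%:R * (Num.sqrt n%:R * l ^+ 3)) +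
     C * (980%:R * (Num.sqrt n%:R * l ^+ 3))))); last first.
  by rewrite le_eqVlt; apply/orP; left; apply/eqP; ring.
apply: ler_pM => //.
- by rewrite !addr_ge0 // mulr_ge0 ?pi_cost_ge0.
- by rewrite natrD natrM; lra.
rewrite addrAC; apply: lerD; last exact: ler_wpM2l.
by rewrite ler_peMr // addr_ge0.
Qed.

End Real.

(** * The algorithm for the nth prime *)

(** The exponent 6 splits as 4 + 2: [81 <= (n + 2) ^ 4] absorbs the constants, as
[1 <= n]. *)
Lemma square_word_bound (n X : nat) :
  (0 < n -> X <= 32 * n ^ 2 -> X + 2 <= (n + 2) ^ 6)%N.
Proof.
move=> n_gt0 le_X; rewrite (expnD _ 4 2).
have le4 : (3 ^ 4 <= (n + 2) ^ 4)%N by rewrite leq_exp2r // addn2.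
apply: leq_trans (leq_mul le4 (leqnn _)).
by move: le_X; rewrite -!mulnn; nia.
Qed.

(* The hypothesis on [hkm] is the known running time of the algorithm of
   Hirsch, Kessler and Mendlovic for evaluating the prime counting function. *)
Theorem lemma3p2 (R : realType) (hkm : prog)
    (hkm_time : computes hkm primepi
       (fun x : nat => Num.sqrt x%:R * ln x%:R `^ (5%:R / 2%:R) : R)) :
  exists p : prog,
    computes p nth_prime (fun n : nat => Num.sqrt n%:R * ln n%:R ^+ 4 : R).
Proof.
exists (search hkm).
have [k [T [hkm_ok O_T]]] := hkm_time.
have [C [D [C_ge0 D_ge0 le_T]]] := eqO_affine_bound O_T (@pi_cost_ge0 R).
pose K : R := 30%:R * (8%:R * (D + 10%:R) + 980%:R * C).
have K_gt0 : 0 < K by rewrite /K; lra.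
(* The exponent k.+1 instead of k makes the bound dominate 2 ^ j itself, even
   for k = 0. *)
have run n : exists t : nat, (0 < n)%N ->
    (exists2 m : memory,
       exec ((n + 2) ^ (6 * k.+1)) (search hkm) (init_memory n) m t
       & m 0%N = nth_prime n) /\
    ((1 < n)%N -> t%:R <= K * (Num.sqrt n%:R * ln n%:R ^+ 4)).
  have [->|n_gt0] := posnP n; first by exists 0%N.
  have [j [le_nj lt_n le_j]] := first_pow2_primepi n_gt0.
  have le_X := pow2_le_32_square le_j.
  (* The shift leaves out T 0, which is unconstrained. *)
  pose tau := \max_(x < 2 ^ j) T x.+1.
  have pow_gt0 : (0 < 2 ^ j)%N by rewrite expn_gt0.
  have [pow_bound n_bound] :
      (2 ^ j + 2 <= (n + 2) ^ (6 * k.+1) /\ n <= (n + 2) ^ (6 * k.+1))%N.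
    split; last first.
      rewrite (leq_trans (leq_addr 2 n)) // -{1}(expn1 (n + 2)) leq_pexp2l //.
      by rewrite addn2.
    rewrite expnM (leq_trans (square_word_bound n_gt0 le_X)) //.
    by rewrite -{1}(expn1 (_ ^ 6)) leq_pexp2l // expn_gt0 addn2.
  have B_gt1 := leq_trans (leq_addl (2 ^ j) 2) pow_bound.
  have hkm_run x : (0 < x <= 2 ^ j)%N ->
      terminates ((n + 2) ^ (6 * k.+1)) hkm (init_memory x) tau
        (fun m => m 0%N = primepi x).
    move=> /andP[x_gt0 le_x]; have [m ex_m m0] := hkm_ok x x_gt0.
    exists m, (T x); split=> //.
      apply: exec_le_word ex_m; rewrite expnM.
      apply: (@leq_trans ((2 ^ j + 2) ^ k.+1)).
        apply: (@leq_trans ((x + 2) ^ k.+1)); first by rewrite leq_pexp2l // addn2.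
        by rewrite leq_exp2r // leq_add2r.
      by rewrite leq_exp2r // square_word_bound.
    case: x x_gt0 le_x {ex_m m0} => // x _ lt_x.
    exact: (@leq_bigmax _ (fun x : 'I_(2 ^ j) => T x.+1) (Ordinal lt_x)).
  have [m [t [ex_m le_t [v pi_v m0]]]] :=
    search_correct hkm_run B_gt1 n_bound (leq_trans (leq_addr 2 _) pow_bound)
      n_gt0 le_nj lt_n.
  exists t => _; split=> [|n_gt1].
    by exists m => //; rewrite m0 (nth_prime_unique pi_v).
  apply: le_trans (search_cost_le n_gt1 le_j C_ge0 D_ge0).
  have [x0 def_tau] : {x0 : 'I_(2 ^ j) | tau = T x0.+1}.
    by apply: bigop.eq_bigmax; rewrite card_ord.
  apply: (@le_trans _ _ ((2 * j + 1) * (tau + 10))%:R); first by rewrite ler_nat.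
  rewrite natrM [(tau + 10)%:R]natrD ler_wpM2l // lerD2r def_tau (le_trans (le_T _)) //.
  by rewrite lerD2l ler_wpM2l // pi_cost_mono /=.
have [t t_ok] := choice run.
exists (6 * k.+1)%N, t; split=> [n /t_ok [] //|].
apply/eqO_exP; exists K => //.
exists 2%N => // n n_gt1.
have [_ /(_ n_gt1)] := t_ok n (ltnW n_gt1).
by rewrite /= !ger0_norm ?mulr_ge0 ?sqrtr_ge0 ?exprn_ge0 ?ln_ge0 // ler1n ltnW.
Qed.
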